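(* Let $\alpha,\beta\in\mathbf{C}$ with $|\alpha|^2+|\beta|^2=1$, let $\{e_1,e_2,e_3\}$ be the standard basis of $\mathbf{C}^3$, and define matrices in $M_3(\mathbf{C})$ by $$A_1=\alpha|e_1\rangle\langle e_1|+|e_2\rangle\langle e_3|,\qquad A_2=\beta|e_1\rangle\langle e_3|+|e_3\rangle\langle e_2|,$$ $$A_3=-|e_1\rangle\langle e_2|-\overline{\beta}\,|e_3\rangle\langle e_1|,\qquad A_4=|e_2\rangle\langle e_1|+\overline{\alpha}\,|e_3\rangle\langle e_3|.$$ Let $\Phi_{\alpha,\beta}(\rho)=\tfrac12\sum_{k=1}^4A_k^*\rho A_k$ for $\rho\in M_3(\mathbf{C})$. If $|\alpha|^2\notin\{0,\tfrac12,1\}$, then $\Phi_{\alpha,\beta}$ is an extreme point of the convex set of UCPT maps on $M_3(\mathbf{C})$. Moreover, for all $\alpha,\beta$ with $|\alpha|^2+|\beta|^2=1$, $\Phi_{\alpha,\beta}$ has an exact factorization through $M_3(\mathbf{C})\otimes M_2(\mathbf{C})$.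
   Context: A UCPT map on $M_d(\mathbf{C})$ is a linear map $M_d(\mathbf{C})\to M_d(\mathbf{C})$ that is completely positive, unital and trace-preserving. A UCPT map $\Phi$ on $M_d(\mathbf{C})$ has an exact factorization through $M_d(\mathbf{C})\otimes M_\nu(\mathbf{C})$ if there is a unitary $\mathbf{U}\in M_d(\mathbf{C})\otimes M_\nu(\mathbf{C})$ such that $\Phi(\rho)=(\mathcal{I}\otimes\mathrm{Tr})\big(\mathbf{U}^*(\rho\otimes\tfrac1\nu I_\nu)\mathbf{U}\big)$ for all $\rho\in M_d(\mathbf{C})$, where $\mathcal{I}$ is the identity map on $M_d(\mathbf{C})$ and $\mathrm{Tr}$ is the usual (unnormalized) trace on $M_\nu(\mathbf{C})$. The notation $|x\rangle\langle y|$ denotes the rank-one operator $z\mapsto\langle y,z\rangle x$. *)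

(* Defs.v *)
From HB Require Import structures.
From mathcomp Require Import all_boot all_order all_algebra.
From mathcomp Require Import complex mxtens.
From mathcomp Require Import all_classical all_reals.

Set Implicit Arguments.
Unset Strict Implicit.
Unset Printing Implicit Defensive.

Import Order.TTheory GRing.Theory Num.Theory.

Local Open Scope classical_set_scope.
Local Open Scope ring_scope.
Local Open Scope complex_scope.
Local Open Scope sesquilinear_scope.

Section Defs.
Variable R : realType.
Local Notation C := R[i].

Definition extreme_point (V : lmodType C) (K : set V) (x : V) : Prop :=
  K x /\ forall (y z : V) (t : R), K y -> K z -> 0 < t < 1 ->
    x = t%:C *: y + (1 - t)%:C *: z -> y = x /\ z = x.

(* In C, 0 <= z entails that z is real, so such an A is Hermitian. *)
Definition psdmx n (A : 'M[C]_n) : Prop :=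
  forall x : 'cV[C]_n, 0 <= (x^t* *m A *m x) 0 0.

(* M_d (x) M_n is identified with 'M_(d * n) through the Kronecker product *t;
   block X i j is then the coefficient in M_d of delta_mx i j, that is,
   X = \sum_i \sum_j block X i j *t delta_mx i j. *)
Definition block d n (X : 'M[C]_(d * n)) (i j : 'I_n) : 'M[C]_d :=
  \matrix_(a, b) X (mxtens_index (a, i)) (mxtens_index (b, j)).

Lemma block_tens d n (A : 'M[C]_d) (B : 'M[C]_n) i j :
  block (A *t B) i j = B i j *: A.
Proof. by apply/matrixP=> a b; rewrite !mxE !mxtens_indexK mulrC. Qed.

(* The partial trace I (x) Tr : M_d (x) M_n -> M_d. *)
Definition ptrace d n (X : 'M[C]_(d * n)) : 'M[C]_d := \sum_i block X i i.

Lemma ptrace_tens d n (A : 'M[C]_d) (B : 'M[C]_n) :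
  ptrace (A *t B) = \tr B *: A.
Proof. by rewrite /mxtrace scaler_suml; apply: eq_bigr => i _; rewrite block_tens. Qed.

(* The ampliation Phi (x) I on M_d (x) M_n. *)
Definition ampl d n (Phi : 'M[C]_d -> 'M[C]_d) (X : 'M[C]_(d * n)) :
    'M[C]_(d * n) :=
  \sum_i \sum_j Phi (block X i j) *t delta_mx i j.

Lemma ampl_tens d n (Phi : 'M[C]_d -> 'M[C]_d) (A : 'M[C]_d) (B : 'M[C]_n) :
  scalable Phi -> ampl Phi (A *t B) = Phi A *t B.
Proof.
move=> PhiZ; apply/matrixP => u v.
case: (mxtens_indexP u) => a i; case: (mxtens_indexP v) => b j.
rewrite summxE (bigD1 i)//= [X in _ + X]big1 ?addr0 => [|i' ni'i]; last first.
  rewrite summxE big1// => j' _.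
  by rewrite tensmxE [delta_mx _ _ _ _]mxE eq_sym (negbTE ni'i) mulr0.
rewrite summxE (bigD1 j)//= [X in _ + X]big1 ?addr0 => [|j' nj'j]; last first.
  by rewrite tensmxE [delta_mx _ _ _ _]mxE [j == _]eq_sym (negbTE nj'j) andbF mulr0.
rewrite !tensmxE [delta_mx _ _ _ _]mxE !eqxx mulr1 block_tens PhiZ mxE.
by rewrite mulrC.
Qed.

Definition completely_positive d (Phi : 'M[C]_d -> 'M[C]_d) : Prop :=
  forall (n : nat) (X : 'M[C]_(d * n)), psdmx X -> psdmx (ampl Phi X).

Definition UCPT d : set ('M[C]_d -> 'M[C]_d) :=
  [set Phi | [/\ linear Phi, completely_positive Phi, Phi 1%:M = 1%:M
               & forall rho : 'M[C]_d, \tr (Phi rho) = \tr rho]].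

Definition exact_factorization d (nu : nat) (Phi : 'M[C]_d -> 'M[C]_d) : Prop :=
  UCPT Phi /\
  exists2 U : 'M[C]_(d * nu), U \is unitarymx &
    forall rho : 'M[C]_d, Phi rho =
      ptrace (U^t* *m (rho *t (nu%:R^-1 *: 1%:M)) *m U).

Definition ketbra n (x y : 'cV[C]_n) : 'M[C]_n := x *m y^t*.

Definition kraus (alpha beta : C) : seq 'M[C]_3 :=
  let e1 : 'cV[C]_3 := delta_mx 0 0 in
  let e2 : 'cV[C]_3 := delta_mx 1 0 in
  let e3 : 'cV[C]_3 := delta_mx 2 0 in
  [:: alpha *: ketbra e1 e1 + ketbra e2 e3;
      beta *: ketbra e1 e3 + ketbra e3 e2;
      - ketbra e1 e2 - beta^*%R *: ketbra e3 e1;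
      ketbra e2 e1 + alpha^*%R *: ketbra e3 e3].

Definition Phi_ (alpha beta : C) (rho : 'M[C]_3) : 'M[C]_3 :=
  2^-1 *: \sum_(A <- kraus alpha beta) A^t* *m rho *m A.

End Defs.

(* Main.v *)
(* The four operators are the blocks of U = [[A_1, A_2], [A_3, A_4]], which is
   unitary; this is the exact factorization.

   For extremality, let Phi = t Psi_1 + (1 - t) Psi_2 with Psi_1, Psi_2 UCPT. The
   Choi matrix of Phi is J = c V^* V, where the rows of V are the vectorized A_k.
   As the Choi matrices of Psi_1 and Psi_2 are positive, that of Psi_1 vanishes on
   the kernel of J, hence on that of V, so it has the form V^* M V, that is,
   Psi_1(rho) = \sum_(k, l) M_kl A_k^* rho A_l. Unitality and trace preservation
   say that N = M - c 1 satisfies \sum_(k, l) N_kl A_k^* A_l = 0 and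
   \sum_(k, l) N_kl A_l A_k^* = 0 (the independence condition of Landau and
   Streater), and for the A_k at hand these 18 scalar equations force N = 0. *)
From HB Require Import structures.
Require Import Defs.
From mathcomp Require Import all_boot all_order all_algebra.
From mathcomp Require Import complex mxtens ring lra.
From mathcomp Require Import all_classical all_reals.

Set Implicit Arguments.
Unset Strict Implicit.
Unset Printing Implicit Defensive.

Import Order.TTheory GRing.Theory Num.Theory.

Local Open Scope complex_scope.
Local Open Scope ring_scope.
Local Open Scope sesquilinear_scope.

(** * Adjoints, and quadratics that are nonnegative on the reals *)

Section Adjoint.
Variable C : numClosedFieldType.

Lemma adjmxM m n p (A : 'M[C]_(m, n)) (B : 'M[C]_(n, p)) :
  (A *m B)^t* = B^t* *m A^t*.
Proof. by rewrite trmx_mul map_mxM. Qed.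

Lemma adjmxD m n (A B : 'M[C]_(m, n)) : (A + B)^t* = A^t* + B^t*.
Proof. by rewrite linearD /= map_mxD. Qed.

Lemma adjmxZ m n (c : C) (A : 'M[C]_(m, n)) : (c *: A)^t* = c^* *: A^t*.
Proof. by rewrite linearZ /= map_mxZ. Qed.

Lemma adjmx_mul_eq0 n (x : 'cV[C]_n) : (x^t* *m x) 0 0 = 0 -> x = 0.
Proof.
move=> /eqP; rewrite mxE psumr_eq0 => [/allP x0|i _]; last first.
  by rewrite !mxE mulrC mul_conjC_ge0.
apply/colP => i; have := x0 i (mem_index_enum i).
by rewrite !mxE mulrC mul_conjC_eq0 => /eqP.
Qed.

(** The values s = 1 and s = -1 show that r is nonnegative and S real. At s = -S / (r + 1) the
    expression equals -(S / (r + 1))^2, so S vanishes; dividing by r + 1 instead of r avoids a case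
    r = 0. *)
Lemma ge0_real_quadratic (S r : C) :
  (forall s : C, s \is Num.real -> 0 <= s * S + s ^+ 2 * r) -> S = 0.
Proof.
move=> H.
have H1 := H 1 (real1 _); have H2 := H (-1) (rpredN1 _).
rewrite mul1r expr1n mul1r in H1.
rewrite mulN1r sqrrN expr1n mul1r in H2.
have r0 : 0 <= r.
  have: 0 <= (S + r) + (- S + r) by rewrite addr_ge0.
  by rewrite (_ : _ + _ = r *+ 2) ?pmulrn_lge0 //; ring.
have rS : S \is Num.real.
  rewrite (_ : S = (S + r) - r); last by ring.
  by rewrite rpredB // ger0_real.
have r1 : 0 < r + 1 by rewrite ltr_wpDl.
have r1n : r + 1 != 0 by rewrite gt_eqF.
have rq : S / (r + 1) \is Num.real by rewrite rpred_div // gtr0_real.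
have: 0 <= - (S / (r + 1)) ^+ 2.
  have := H (- (S / (r + 1))); rewrite rpredN rq => /(_ isT).
  by congr (_ <= _); field.
rewrite oppr_ge0 => H3.
have H4 : (S / (r + 1)) ^+ 2 = 0.
  by apply/eqP; rewrite eq_le real_exprn_even_ge0 // H3.
move/eqP: H4; rewrite expf_eq0 mulf_eq0 invr_eq0 (negbTE r1n) orbF.
by move/eqP.
Qed.
End Adjoint.

(** * Positive semidefinite matrices *)

Section Psd.
Variable R : realType.
Local Notation C := R[i].

(** Perturb x in the direction y = J x. The form at x + c y is c p + c^* q + |c|^2 r with q the
    squared norm of y. Real c forces p + q = 0 and imaginary c forces p - q = 0, so q = 0. The
    argument avoids Hermitian symmetry, which is itself deduced from this lemma. *)
Lemma psdmx_isotropic n (J : 'M[C]_n) (x : 'cV[C]_n) :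
  psdmx J -> (x^t* *m J *m x) 0 0 = 0 -> J *m x = 0.
Proof.
move=> Jpsd xJx; set y := J *m x; apply: adjmx_mul_eq0.
set q := (y^t* *m y) 0 0; set p := (x^t* *m J *m y) 0 0.
set r := (y^t* *m J *m y) 0 0.
have expand (c : C) :
    ((x + c *: y)^t* *m J *m (x + c *: y)) 0 0 = c * p + c^* * q + c * c^* * r.
  rewrite adjmxD adjmxZ !mulmxDl !mulmxDr -!scalemxAl -!scalemxAr.
  have addE (M N : 'M[C]_1) : (M + N) 0 0 = M 0 0 + N 0 0 by rewrite mxE.
  have scaleE a (M : 'M[C]_1) : (a *: M) 0 0 = a * M 0 0 by rewrite mxE.
  rewrite !addE !scaleE xJx add0r -/p -/r -(mulmxA _ J x) -/y -/q; ring.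
have Spq : p + q = 0.
  apply: (@ge0_real_quadratic _ _ r) => s /CrealP sr.
  by have := Jpsd (x + s *: y); rewrite expand sr; congr (_ <= _); ring.
have Dpq : 'i * (p - q) = 0.
  apply: (@ge0_real_quadratic _ _ r) => s /CrealP sr.
  have := Jpsd (x + (s * 'i) *: y); rewrite expand rmorphM /= sr conjCi.
  congr (_ <= _); transitivity (s * ('i * (p - q)) - s ^+ 2 * r * ('i ^+ 2)).
    by ring.
  by rewrite sqrCi; ring.
have /eqP : p - q = 0.
  by move/eqP: Dpq; rewrite mulf_eq0 (negbTE (neq0Ci _)) => /eqP.
rewrite subr_eq0 => /eqP pq; move: Spq; rewrite pq => /eqP.
by rewrite -mulr2n mulrn_eq0 => /eqP.
Qed.

(** The form of J takes real values, so that of J^* - J is identically zero. This difference is then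
    positive, every vector is isotropic for it, and basis vectors kill its columns. *)
Lemma psdmx_hermitian n (J : 'M[C]_n) : psdmx J -> J^t* = J.
Proof.
move=> Jpsd; apply/eqP; rewrite -subr_eq0; apply/eqP.
have B0 (x : 'cV[C]_n) : (x^t* *m (J^t* - J) *m x) 0 0 = 0.
  have -> : x^t* *m (J^t* - J) *m x = (x^t* *m J *m x)^t* - x^t* *m J *m x.
    by rewrite mulmxBr mulmxBl !adjmxM trmxCK mulmxA.
  have adjE (M : 'M[C]_1) : (M^t* - M) 0 0 = (M 0 0)^* - M 0 0 by rewrite !mxE.
  by rewrite adjE (CrealP (ger0_real (Jpsd x))) subrr.
have Bpsd : psdmx (J^t* - J) by move=> x; rewrite B0.
apply/matrixP => i j; have := psdmx_isotropic Bpsd (B0 (delta_mx j 0)).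
by rewrite -colE => /colP/(_ i); rewrite !mxE.
Qed.
End Psd.

(** * Tensor products and matrix units *)

Lemma tensmx_suml (R : comPzRingType) (I : Type) (s : seq I) m n p q
    (A : I -> 'M[R]_(m, n)) (B : 'M[R]_(p, q)) :
  (\sum_(i <- s) A i) *t B = \sum_(i <- s) A i *t B.
Proof.
apply/matrixP => u v.
case: (mxtens_indexP u) => a i; case: (mxtens_indexP v) => b j.
rewrite tensmxE !summxE mulr_suml; apply: eq_bigr => k _.
by rewrite tensmxE.
Qed.

Lemma linear_delta_ext (R : pzRingType) (V : lmodType R) m n (f g : 'M[R]_(m, n) -> V) :
  linear f -> linear g ->
  (forall i j, f (delta_mx i j) = g (delta_mx i j)) -> f =1 g.
Proof.
move=> lf lg fg A.
pose F : {linear _ -> _} := HB.pack f (GRing.isLinear.Build _ _ _ _ f lf).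
pose G : {linear _ -> _} := HB.pack g (GRing.isLinear.Build _ _ _ _ g lg).
change (F A = G A); rewrite (matrix_sum_delta A) !linear_sum.
apply: eq_bigr => i _; rewrite !linear_sum; apply: eq_bigr => j _.
by rewrite !linearZ /= fg.
Qed.

Lemma mxtrace_delta_mul (R : comPzRingType) n (i j : 'I_n) (B : 'M[R]_n) :
  \tr (delta_mx i j *m B) = B j i.
Proof.
rewrite -(mul_delta_mx (0 : 'I_1)) -mulmxA mxtrace_mulC -rowE -colE.
by rewrite /mxtrace big_ord1 !mxE.
Qed.

(** * Ampliations and complete positivity *)

Section Channels.
Variable R : realType.
Local Notation C := R[i].

Lemma amplE d n (Phi : 'M[C]_d -> 'M[C]_d) (X : 'M[C]_(d * n)) a i b j :
  ampl Phi X (mxtens_index (a, i)) (mxtens_index (b, j)) = Phi (block X i j) a b.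
Proof.
rewrite summxE (bigD1 i) //= summxE (bigD1 j) //= !big1 ?addr0.
- by rewrite tensmxE mxE !eqxx mulr1.
- by move=> k /negbTE ki; rewrite summxE big1 // => l _;
    rewrite tensmxE mxE eq_sym ki mulr0.
- by move=> l /negbTE lj; rewrite tensmxE mxE [j == l]eq_sym lj andbF mulr0.
Qed.

Lemma ampl_id d n (X : 'M[C]_(d * n)) : ampl id X = X.
Proof.
apply/matrixP => u v.
case: (mxtens_indexP u) => a i; case: (mxtens_indexP v) => b j.
by rewrite amplE mxE.
Qed.

(** Expanding X as [ampl id X], a sum of blocks tensored with matrix units, lets A tensor 1 act term
    by term. *)
Lemma ampl_conj d n (A : 'M[C]_d) (X : 'M[C]_(d * n)) :
  ampl (fun rho => A^t* *m rho *m A) X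
    = (A *t (1%:M : 'M_n))^t* *m X *m (A *t (1%:M : 'M_n)).
Proof.
rewrite -[X in RHS]ampl_id /ampl trmx_tens map_mxT /= trmx1 map_mx1.
rewrite mulmx_sumr mulmx_suml; apply: eq_bigr => i _.
rewrite mulmx_sumr mulmx_suml; apply: eq_bigr => j _.
by rewrite !tensmx_mul mul1mx mulmx1.
Qed.

Lemma completely_positive_conj d (A : 'M[C]_d) :
  completely_positive (fun rho => A^t* *m rho *m A).
Proof.
move=> n X Xpsd x; rewrite ampl_conj !mulmxA -adjmxM -mulmxA.
exact: Xpsd.
Qed.

Lemma completely_positive_sum d (I : Type) (s : seq I)
    (Phi : I -> 'M[C]_d -> 'M[C]_d) :
  (forall i, completely_positive (Phi i)) ->
  completely_positive (fun rho => \sum_(i <- s) Phi i rho).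
Proof.
move=> PhiP n X Xpsd x.
have -> : ampl (fun rho => \sum_(i <- s) Phi i rho) X
    = \sum_(i <- s) ampl (Phi i) X.
  apply/matrixP => u v.
  case: (mxtens_indexP u) => a i; case: (mxtens_indexP v) => b j.
  by rewrite amplE !summxE; apply: eq_bigr => k _; rewrite amplE.
rewrite mulmx_sumr mulmx_suml summxE.
by apply: sumr_ge0 => k _; apply: PhiP.
Qed.

Lemma completely_positiveZ d (c : C) (Phi : 'M[C]_d -> 'M[C]_d) : 0 <= c ->
  completely_positive Phi -> completely_positive (fun rho => c *: Phi rho).
Proof.
move=> c0 PhiP n X Xpsd x.
have -> : ampl (fun rho => c *: Phi rho) X = c *: ampl Phi X.
  apply/matrixP => u v.
  case: (mxtens_indexP u) => a i; case: (mxtens_indexP v) => b j.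
  by rewrite !mxE !amplE mxE.
rewrite -scalemxAr -scalemxAl mxE.
by apply: mulr_ge0 => //; apply: PhiP.
Qed.

(** * Choi matrices and Kraus forms *)

Definition maxent d : 'cV[C]_(d * d) :=
  \col_u ((mxtens_unindex u).1 == (mxtens_unindex u).2)%:R.

(** Written as an ampliation at a rank-one positive matrix, so that complete positivity gives its
    positivity at once; [choiE] recovers the usual entries. *)
Definition choi d (Phi : 'M[C]_d -> 'M[C]_d) : 'M[C]_(d * d) :=
  ampl Phi (maxent d *m (maxent d)^t*).

Lemma choiE d (Phi : 'M[C]_d -> 'M[C]_d) a i b j :
  choi Phi (mxtens_index (a, i)) (mxtens_index (b, j)) = Phi (delta_mx i j) a b.
Proof.
rewrite amplE; congr (Phi _ a b); apply/matrixP => k l.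
by rewrite !mxE big_ord1 !mxE !mxtens_indexK /= conjC_nat -natrM mulnb.
Qed.

Lemma choi_psd d (Phi : 'M[C]_d -> 'M[C]_d) :
  completely_positive Phi -> psdmx (choi Phi).
Proof.
apply => x; set w := maxent d.
have -> : x^t* *m (w *m w^t*) *m x = (w^t* *m x)^t* *m (w^t* *m x).
  by rewrite adjmxM trmxCK !mulmxA.
rewrite mxE sumr_ge0 // => i _.
by rewrite 2!mxE mulrC mul_conjC_ge0.
Qed.

Lemma choi_inj d (Phi Psi : 'M[C]_d -> 'M[C]_d) :
  linear Phi -> linear Psi -> choi Phi = choi Psi -> Phi = Psi.
Proof.
move=> lPhi lPsi eqJ; apply/funext; apply: linear_delta_ext => // i j.
by apply/matrixP => a b; rewrite -!choiE eqJ.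
Qed.

(* With [M] scalar this is a Kraus decomposition. *)
Definition kraus_form d m (A : 'I_m -> 'M[C]_d) (M : 'M[C]_m) (rho : 'M[C]_d) :=
  \sum_k \sum_l M k l *: ((A k)^t* *m rho *m A l).

Lemma kraus_form_linear d m (A : 'I_m -> 'M[C]_d) M : linear (kraus_form A M).
Proof.
move=> c rho sigma; rewrite /kraus_form scaler_sumr -big_split /=.
apply: eq_bigr => k _; rewrite scaler_sumr -big_split /=.
apply: eq_bigr => l _.
by rewrite mulmxDr mulmxDl -scalemxAr -scalemxAl scalerDr !scalerA mulrC.
Qed.

Lemma kraus_formB d m (A : 'I_m -> 'M[C]_d) M N rho :
  kraus_form A (M - N) rho = kraus_form A M rho - kraus_form A N rho.
Proof.
rewrite /kraus_form -sumrB; apply: eq_bigr => k _; rewrite -sumrB.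
by apply: eq_bigr => l _; rewrite !mxE scalerBl.
Qed.

Lemma kraus_form_scalar d m (A : 'I_m -> 'M[C]_d) c rho :
  kraus_form A c%:M rho = c *: \sum_k (A k)^t* *m rho *m A k.
Proof.
rewrite scaler_sumr; apply: eq_bigr => k _; rewrite (bigD1 k) //= mxE eqxx.
by rewrite big1 ?addr0 // => l /negbTE lk; rewrite mxE eq_sym lk scale0r.
Qed.

(** The tensor index (a, i) selects the entry (i, a): the (a, b) entry of A_k^* E_ij A_l is the
    conjugate of A_k(i, a) times A_l(j, b), so this order matches that of [choiE]. *)
Definition vec_family d m (A : 'I_m -> 'M[C]_d) : 'M[C]_(m, d * d) :=
  \matrix_(k, u) A k (mxtens_unindex u).2 (mxtens_unindex u).1.

Lemma choi_kraus_form d m (A : 'I_m -> 'M[C]_d) M :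
  choi (kraus_form A M) = (vec_family A)^t* *m M *m vec_family A.
Proof.
apply/matrixP => u v.
case: (mxtens_indexP u) => a i; case: (mxtens_indexP v) => b j.
rewrite choiE summxE -mulmxA mxE; apply: eq_bigr => k _.
rewrite summxE [(M *m _) _ _]mxE mulr_sumr; apply: eq_bigr => l _.
rewrite -(mul_delta_mx (0 : 'I_1)) mulmxA -mulmxA -rowE -colE.
by rewrite !mxE big_ord1 !mxE !mxtens_indexK /= mulrCA mulrA.
Qed.

(** * The extremality criterion *)

Lemma psdmx_sub_kernel n (J J1 J2 : 'M[C]_n) (t : R) : 0 < t < 1 ->
  psdmx J1 -> psdmx J2 -> J = t%:C *: J1 + (1 - t)%:C *: J2 ->
  forall x : 'cV[C]_n, J *m x = 0 -> J1 *m x = 0.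
Proof.
move=> /andP[t0 t1] J1psd J2psd -> x Jx.
apply: psdmx_isotropic => //.
have tC0 : 0 < t%:C by rewrite ltcR.
have tC1 : 0 < (1 - t)%:C by rewrite ltcR subr_gt0.
have addE (M N : 'M[C]_1) : (M + N) 0 0 = M 0 0 + N 0 0 by rewrite mxE.
have scaleE a (M : 'M[C]_1) : (a *: M) 0 0 = a * M 0 0 by rewrite mxE.
(* The form of J at x is a sum of two nonnegative terms, so both vanish, and t is nonzero. *)
have : (x^t* *m ((t%:C *: J1 + (1 - t)%:C *: J2) *m x)) 0 0 = 0.
  by rewrite Jx mulmx0 mxE.
rewrite mulmxA mulmxDr mulmxDl -!scalemxAr -!scalemxAl addE !scaleE => /eqP.
rewrite paddr_eq0 ?(mulr_ge0 (ltW _)) // => /andP[+ _].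
by rewrite mulf_eq0 (gt_eqF tC0) => /eqP.
Qed.

(** Inclusion of kernels means that the row space of J lies in that of V, so J = J P V with P a
    pseudo-inverse of V. Taking adjoints, J = V^* P^* J, and the two combine with M = P^* J P. *)
Lemma cokermx_factor n m (J : 'M[C]_n) (V : 'M[C]_(m, n)) : J^t* = J ->
  (forall x : 'cV[C]_n, V *m x = 0 -> J *m x = 0) ->
  exists M : 'M[C]_m, J = V^t* *m M *m V.
Proof.
move=> Jherm kerVJ.
have /mulmxKpV JV : (J <= V)%MS.
  rewrite submxE; apply/eqP/matrixP => i j; rewrite [RHS]mxE.
  have : J *m (cokermx V *m delta_mx j 0) = 0 :> 'cV_n.
    by apply: kerVJ; rewrite mulmxA mulmx_coker mul0mx.
  by rewrite mulmxA -colE => /colP/(_ i); rewrite !mxE.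
move: (pinvmx V) JV => P JV; exists (P^t* *m J *m P).
have VJ : V^t* *m P^t* *m J = J.
  by rewrite -[in RHS]Jherm -[in RHS]JV !adjmxM Jherm !mulmxA.
by rewrite !mulmxA VJ JV.
Qed.

Lemma kraus_form_convex_part d m (A : 'I_m -> 'M[C]_d) c
    (Psi1 Psi2 : 'M[C]_d -> 'M[C]_d) (t : R) :
  0 < t < 1 -> UCPT Psi1 -> UCPT Psi2 ->
  kraus_form A c%:M = t%:C *: Psi1 + (1 - t)%:C *: Psi2 ->
  exists M, Psi1 = kraus_form A M.
Proof.
move=> t01 [lin1 cp1 _ _] [_ cp2 _ _] eqPhi.
have eqJ : choi (kraus_form A c%:M)
    = t%:C *: choi Psi1 + (1 - t)%:C *: choi Psi2.
  apply/matrixP => u v.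
  case: (mxtens_indexP u) => a i; case: (mxtens_indexP v) => b j.
  by rewrite choiE eqPhi !mxE !choiE.
have [|x Vx|M JM] := @cokermx_factor _ _ (choi Psi1) (vec_family A).
- exact/psdmx_hermitian/choi_psd.
- apply: (psdmx_sub_kernel t01 (choi_psd cp1) (choi_psd cp2) eqJ).
  by rewrite choi_kraus_form -(mulmxA _ _ x) Vx mulmx0.
- exists M; apply: choi_inj => //; first exact: kraus_form_linear.
  by rewrite choi_kraus_form.
Qed.

(** Cyclicity of the trace passes to the dual map at the identity, which turns trace preservation
    into a matrix equation in the A_l A_k^* . *)
Lemma mxtrace_kraus_form d m (A : 'I_m -> 'M[C]_d) M rho :
  \tr (kraus_form A M rho)
    = \tr (rho *m \sum_k \sum_l M k l *: (A l *m (A k)^t*)).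
Proof.
rewrite mulmx_sumr !linear_sum; apply: eq_bigr => k _.
rewrite mulmx_sumr !linear_sum; apply: eq_bigr => l _ /=.
by rewrite -scalemxAr !linearZ /= -mulmxA mxtrace_mulC mulmxA.
Qed.

(** The independence hypothesis says that the m^2 pairs formed by A_k^* A_l and A_l A_k^* are
    linearly independent in the direct sum of two copies of M_d. *)
Lemma kraus_form_extreme d m (A : 'I_m -> 'M[C]_d) c :
  UCPT (kraus_form A c%:M) ->
  (forall M : 'M[C]_m,
     \sum_k \sum_l M k l *: ((A k)^t* *m A l) = 0 ->
     \sum_k \sum_l M k l *: (A l *m (A k)^t*) = 0 -> M = 0) ->
  extreme_point (@UCPT R d) (kraus_form A c%:M).
Proof.
move=> PhiU indep; split=> // Psi1 Psi2 t U1 U2 t01 eqPhi.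
(* Stated for an arbitrary weight to serve both components: the second follows by swapping the
   summands and replacing t by 1 - t. *)
have part Psi (t' : R) Psi' : 0 < t' < 1 -> UCPT Psi -> UCPT Psi' ->
    kraus_form A c%:M = t'%:C *: Psi + (1 - t')%:C *: Psi' ->
    Psi = kraus_form A c%:M.
  move=> t'01 U U' eqPsi.
  have [M PsiM] := kraus_form_convex_part t'01 U U' eqPsi.
  suff /eqP : M - c%:M = 0 by rewrite subr_eq0 PsiM => /eqP ->.
  move: U; rewrite PsiM => -[_ _ unitM traceM].
  have [_ _ unitc tracec] := PhiU.
  apply: indep.
    transitivity (kraus_form A (M - c%:M) 1%:M).
      by apply: eq_bigr => k _; apply: eq_bigr => l _; rewrite mulmx1.
    by rewrite kraus_formB unitM unitc subrr.
  (* Each entry is a trace against a matrix unit, where both maps preserve the trace. *)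
  apply/matrixP => i j; rewrite -mxtrace_delta_mul -mxtrace_kraus_form.
  by rewrite kraus_formB raddfB /= traceM tracec subrr mxE.
split; first exact: part eqPhi.
apply: (part _ (1 - t) Psi1) => //; first by move: t01; lra.
by rewrite eqPhi addrC subKr.
Qed.

End Channels.

(** * Block matrices and the partial trace *)

Section Blocks.
Variable R : realType.
Local Notation C := R[i].

Lemma block_inj d n (X Y : 'M[C]_(d * n)) :
  (forall i j, block X i j = block Y i j) -> X = Y.
Proof.
move=> eqXY; apply/matrixP => u v.
case: (mxtens_indexP u) => a i; case: (mxtens_indexP v) => b j.
by have /matrixP/(_ a b) := eqXY i j; rewrite !mxE.
Qed.

Lemma block_mul d n (X Y : 'M[C]_(d * n)) i j :
  block (X *m Y) i j = \sum_k block X i k *m block Y k j.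
Proof.
apply/matrixP => a b; rewrite summxE !mxE.
rewrite (reindex (@mxtens_index d n)) /=; last first.
  exists (@mxtens_unindex d n) => u _; [exact: mxtens_indexK|exact: mxtens_unindexK].
transitivity (\sum_c \sum_k X (mxtens_index (a, i)) (mxtens_index (c, k)) *
    Y (mxtens_index (c, k)) (mxtens_index (b, j))).
  by rewrite pair_bigA /=; apply: eq_bigr => -[c k] _.
rewrite exchange_big; apply: eq_bigr => k _; rewrite mxE.
by apply: eq_bigr => c _; rewrite !mxE.
Qed.

Lemma block_adj d n (X : 'M[C]_(d * n)) i j : block (X^t*) i j = (block X j i)^t*.
Proof. by apply/matrixP => a b; rewrite !mxE. Qed.

Lemma block1 d n (i j : 'I_n) :
  block (1%:M : 'M[C]_(d * n)) i j = (1%:M : 'M_n) i j *: 1%:M.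
Proof.
apply/matrixP => a b; rewrite !mxE (can_eq (@mxtens_indexK d n)) xpair_eqE.
by rewrite mulr_natl -mulrnA mulnb andbC.
Qed.

Definition block_matrix d n (A : 'I_n -> 'I_n -> 'M[C]_d) : 'M[C]_(d * n) :=
  \matrix_(u, v) A (mxtens_unindex u).2 (mxtens_unindex v).2
                   (mxtens_unindex u).1 (mxtens_unindex v).1.

Lemma block_block_matrix d n (A : 'I_n -> 'I_n -> 'M[C]_d) i j :
  block (block_matrix A) i j = A i j.
Proof. by apply/matrixP => a b; rewrite !mxE !mxtens_indexK. Qed.

Lemma block_matrix_unitary d n (A : 'I_n -> 'I_n -> 'M[C]_d) :
  (forall i k, \sum_j A i j *m (A k j)^t* = (1%:M : 'M_n) i k *: 1%:M) ->
  block_matrix A \is unitarymx.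
Proof.
move=> orthA; apply/unitarymxP; apply: block_inj => i k.
rewrite block_mul block1 -orthA; apply: eq_bigr => j _.
by rewrite block_adj !block_block_matrix.
Qed.

(** The off-diagonal blocks of rho tensor c 1 vanish, so only the terms pairing a block with itself
    survive. *)
Lemma ptrace_conj_block_matrix d n (A : 'I_n -> 'I_n -> 'M[C]_d) c rho :
  ptrace ((block_matrix A)^t* *m (rho *t (c *: 1%:M)) *m block_matrix A)
    = c *: \sum_i \sum_j (A i j)^t* *m rho *m A i j.
Proof.
rewrite exchange_big scaler_sumr; apply: eq_bigr => j _ /=.
rewrite block_mul scaler_sumr; apply: eq_bigr => i _.
rewrite block_mul (bigD1 i) //= big1 => [|k /negbTE ki].
  rewrite addr0 block_adj !block_block_matrix block_tens !mxE eqxx mulr1.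
  by rewrite -scalemxAr -scalemxAl.
by rewrite block_tens !mxE ki mulr0 scale0r mulmx0.
Qed.

End Blocks.

(** * Two small linear systems *)

Lemma off_diagonal_eq0 (F : fieldType) (a b b' x y z : F) :
  a != 0 -> 1 - (b * b') *+ 2 != 0 ->
  a * y = - (b * x) -> a * z = b * x -> a * b' * (z - y) = x ->
  [/\ x = 0, y = 0 & z = 0].
Proof.
move=> a0 bb ay az xE.
(* The first two equations give a (z - y) = 2 b x; the third then reads x = 2 b b' x. *)
have e : x = b' * (b * x) + b' * (b * x).
  by rewrite -{1}xE -{1}az -[b * x]opprK -ay; ring.
have x0 : x = 0 by apply: (mulfI bb); rewrite mulr0 mulrBl mul1r {1}e; ring.
by split=> //; apply: (mulfI a0); rewrite ?ay ?az x0 !mulr0 ?oppr0.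
Qed.

(** Eliminating z = -y and w = -x turns the last two equations into p (x - y) = 0 and -q (x + y) =
    0. *)
Lemma diagonal_eq0 (F : numFieldType) (p q x y z w : F) :
  p + q = 1 -> p != 0 -> q != 0 ->
  y + z = 0 -> x + w = 0 -> p * x + q * y + z = 0 -> p * x + q * z + w = 0 ->
  [/\ x = 0, y = 0, z = 0 & w = 0].
Proof.
move=> pq p0 q0 yz xw e1 e2; have qE : q = 1 - p by rewrite -pq; ring.
have zE : z = - y by apply/eqP; rewrite -addr_eq0 addrC yz.
have wE : w = - x by apply/eqP; rewrite -addr_eq0 addrC xw.
have xBy : x - y = 0.
  by apply: (mulfI p0); rewrite mulr0 -e1 zE qE; ring.
have xDy : x + y = 0.
  apply: (mulfI q0); rewrite mulr0 -oppr0 -e2 zE wE.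
  by rewrite (_ : p = 1 - q) ?qE; ring.
have /eqP : x *+ 2 = 0 by rewrite -(addr0 0) -{1}xBy -xDy; ring.
rewrite mulrn_eq0 /= => /eqP x0; move: xDy; rewrite x0 add0r => y0.
by rewrite zE wE x0 y0 oppr0.
Qed.

(** * The four Kraus operators and their map *)

Section Example.
Variable R : realType.
Local Notation C := R[i].

Lemma ketbra_delta n (i j : 'I_n) :
  ketbra (delta_mx i 0) (delta_mx j 0) = delta_mx i j :> 'M[C]_n.
Proof.
by rewrite /ketbra trmx_delta map_delta_mx mul_delta_mx.
Qed.

(* Indices start at 0: [kraus_op alpha beta k] is A_(k+1), and row or column [i]
   belongs to e_(i+1). *)
Definition kraus_op (alpha beta : C) (k : nat) : 'M[C]_3 := (kraus alpha beta)`_k.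

(** A table on natural numbers, so that entries at concrete indices reduce by computation once the
    finite sums are expanded. *)
Definition kraus_entry (alpha beta : C) (k a b : nat) : C :=
  match k, a, b with
  | 0, 0, 0 => alpha     | 0, 1, 2 => 1
  | 1, 0, 2 => beta      | 1, 2, 1 => 1
  | 2, 0, 1 => -1        | 2, 2, 0 => - beta^*
  | 3, 1, 0 => 1         | 3, 2, 2 => alpha^*
  | _, _, _ => 0
  end.

Lemma kraus_opE alpha beta (k a b : nat) (a3 : (a < 3)%N) (b3 : (b < 3)%N) :
  (k < 4)%N ->
  kraus_op alpha beta k (Ordinal a3) (Ordinal b3) = kraus_entry alpha beta k a b.
Proof.
rewrite /kraus_op /kraus !ketbra_delta.
move: a b a3 b3 => [|[|[|//]]] [|[|[|//]]] a3 b3; move: k => [|[|[|[|//]]]] _ /=.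
all: by rewrite !mxE /= ?mulr0n ?mulr1n ?(mulr0, mulr1, addr0, add0r, oppr0).
Qed.

(** The coefficients [m] are arbitrary: half the Kronecker delta yields unitality, and a general
    matrix yields half of the independence equations. The final catch-all case is the entry (2,
    2). *)
Lemma kraus_left_gramE alpha beta (m : nat -> nat -> C) (a b : 'I_3) :
  (\sum_(k < 4) \sum_(l < 4)
     m k l *: ((kraus_op alpha beta k)^t* *m kraus_op alpha beta l)) a b =
  match val a, val b with
  | 0, 0 => alpha * alpha^* * m 0%N 0%N + beta * beta^* * m 2%N 2%N + m 3%N 3%N
  | 0, 1 => - alpha^* * m 0%N 2%N - beta * m 2%N 1%N
  | 0, 2 => alpha^* * beta * (m 0%N 1%N - m 2%N 3%N) + m 3%N 0%N
  | 1, 0 => - beta^* * m 1%N 2%N - alpha * m 2%N 0%N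
  | 1, 1 => m 1%N 1%N + m 2%N 2%N
  | 1, 2 => alpha^* * m 1%N 3%N - beta * m 2%N 1%N
  | 2, 0 => alpha * beta^* * (m 1%N 0%N - m 3%N 2%N) + m 0%N 3%N
  | 2, 1 => alpha * m 3%N 1%N - beta^* * m 1%N 2%N
  | _, _ => m 0%N 0%N + beta * beta^* * m 1%N 1%N + alpha * alpha^* * m 3%N 3%N
  end.
Proof.
have -> : (\sum_(k < 4) \sum_(l < 4)
     m k l *: ((kraus_op alpha beta k)^t* *m kraus_op alpha beta l)) a b =
    \sum_(k < 4) \sum_(l < 4) m k l * \sum_(c < 3)
      (kraus_entry alpha beta k c a)^* * kraus_entry alpha beta l c b.
  rewrite summxE; apply: eq_bigr => k _; rewrite summxE; apply: eq_bigr => l _.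
  rewrite !mxE; congr (_ * _); apply: eq_bigr => -[c c3] _.
  by case: a b => [a a3] [b b3]; rewrite !mxE !kraus_opE.
rewrite !big_ord_recl !big_ord0 /=.
case: a b => [[|[|[|//]]] a3] [[|[|[|//]]] b3] /=.
all: rewrite ?rmorphN /= ?(conjC0, conjC1, conjCK); ring.
Qed.

(** The counterpart for trace preservation. *)
Lemma kraus_right_gramE alpha beta (m : nat -> nat -> C) (a b : 'I_3) :
  (\sum_(k < 4) \sum_(l < 4)
     m k l *: (kraus_op alpha beta l *m (kraus_op alpha beta k)^t*)) a b =
  match val a, val b with
  | 0, 0 => alpha * alpha^* * m 0%N 0%N + beta * beta^* * m 1%N 1%N + m 2%N 2%N
  | 0, 1 => beta * m 0%N 1%N + alpha * m 3%N 0%N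
  | 0, 2 => alpha * beta * (m 3%N 1%N - m 2%N 0%N) - m 1%N 2%N
  | 1, 0 => beta^* * m 1%N 0%N + alpha^* * m 0%N 3%N
  | 1, 1 => m 0%N 0%N + m 3%N 3%N
  | 1, 2 => alpha * m 3%N 0%N - beta * m 2%N 3%N
  | 2, 0 => alpha^* * beta^* * (m 1%N 3%N - m 0%N 2%N) - m 2%N 1%N
  | 2, 1 => alpha^* * m 0%N 3%N - beta^* * m 3%N 2%N
  | _, _ => m 1%N 1%N + beta * beta^* * m 2%N 2%N + alpha * alpha^* * m 3%N 3%N
  end.
Proof.
have -> : (\sum_(k < 4) \sum_(l < 4)
     m k l *: (kraus_op alpha beta l *m (kraus_op alpha beta k)^t*)) a b =
    \sum_(k < 4) \sum_(l < 4) m k l * \sum_(c < 3)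
      kraus_entry alpha beta l a c * (kraus_entry alpha beta k b c)^*.
  rewrite summxE; apply: eq_bigr => k _; rewrite summxE; apply: eq_bigr => l _.
  rewrite !mxE; congr (_ * _); apply: eq_bigr => -[c c3] _.
  by case: a b => [a a3] [b b3]; rewrite !mxE !kraus_opE.
rewrite !big_ord_recl !big_ord0 /=.
case: a b => [[|[|[|//]]] a3] [[|[|[|//]]] b3] /=.
all: rewrite ?rmorphN /= ?(conjC0, conjC1, conjCK); ring.
Qed.

Lemma Phi_kraus_form (alpha beta : C) : Phi_ alpha beta =
  kraus_form (fun k : 'I_4 => kraus_op alpha beta k) (2^-1)%:M.
Proof.
apply/funext => rho; rewrite kraus_form_scalar /Phi_ (big_nth 0) big_mkord.
by [].
Qed.

Variables (alpha beta : C).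
Hypothesis hab : `|alpha| ^+ 2 + `|beta| ^+ 2 = 1.

Lemma Phi_UCPT : UCPT (Phi_ alpha beta).
Proof.
have hab' : beta * beta^* = 1 - alpha * alpha^*.
  by rewrite -!normCK -hab; ring.
have e k l : (2^-1%:M : 'M[C]_4) k l = 2^-1 *+ (val k == val l) by rewrite mxE.
have lin : linear (Phi_ alpha beta).
  by rewrite Phi_kraus_form; apply: kraus_form_linear.
split=> //.
- apply: completely_positiveZ; first by rewrite invr_ge0 ler0n.
  by apply: completely_positive_sum => A; apply: completely_positive_conj.
- rewrite Phi_kraus_form; apply/matrixP => a b.
  transitivity ((\sum_(k < 4) \sum_(l < 4) (2^-1 *+ (val k == val l)) *:
     ((kraus_op alpha beta k)^t* *m kraus_op alpha beta l)) a b).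
    by congr (fun_of_matrix _ a b); apply: eq_bigr => k _; apply: eq_bigr => l _;
      rewrite e mulmx1.
  rewrite (kraus_left_gramE alpha beta (fun k l => 2^-1 *+ (k == l))) mxE.
  by case: a b => [[|[|[|//]]] a3] [[|[|[|//]]] b3] /=; rewrite ?hab'; field.
- move=> rho; rewrite Phi_kraus_form mxtrace_kraus_form -[in RHS](mulmx1 rho).
  congr (\tr (_ *m _)); apply/matrixP => a b.
  transitivity ((\sum_(k < 4) \sum_(l < 4) (2^-1 *+ (val k == val l)) *:
     (kraus_op alpha beta l *m (kraus_op alpha beta k)^t*)) a b).
    by congr (fun_of_matrix _ a b); apply: eq_bigr => k _; apply: eq_bigr => l _;
      rewrite e.
  rewrite (kraus_right_gramE alpha beta (fun k l => 2^-1 *+ (k == l))) mxE.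
  by case: a b => [[|[|[|//]]] a3] [[|[|[|//]]] b3] /=; rewrite ?hab'; field.
Qed.

Lemma Phi_exact_factorization : exact_factorization 2 (Phi_ alpha beta).
Proof.
have hab' : beta * beta^* = 1 - alpha * alpha^*.
  by rewrite -!normCK -hab; ring.
split; first exact: Phi_UCPT.
(* Row-major numbering from 0: block (i, j) is the operator of index 2i + j. *)
exists (block_matrix (fun i j : 'I_2 => kraus_op alpha beta (i.*2 + j))).
  apply: block_matrix_unitary => i k; apply/matrixP => a b.
  rewrite !big_ord_recl big_ord0 addr0 mxE ![(_ *m _) a b]mxE.
  transitivity (\sum_(c < 3) kraus_entry alpha beta i.*2 a c *
      (kraus_entry alpha beta k.*2 b c)^* +
    \sum_(c < 3) kraus_entry alpha beta i.*2.+1 a c *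
      (kraus_entry alpha beta k.*2.+1 b c)^*).
    congr (_ + _); apply: eq_bigr => -[c c3] _;
    case: a b => [a a3] [b b3]; rewrite !mxE;
    by case: i k => [[|[|//]] i2] [[|[|//]] k2]; rewrite !kraus_opE.
  rewrite !big_ord_recl !big_ord0 !mxE /=.
  case: a b => [[|[|[|//]]] a3] [[|[|[|//]]] b3];
    case: i k => [[|[|//]] i2] [[|[|//]] k2] /=;
    rewrite ?rmorphN /= ?(conjC0, conjC1, conjCK); ring: hab'.
move=> rho; rewrite ptrace_conj_block_matrix Phi_kraus_form kraus_form_scalar.
by rewrite !big_ord_recl !big_ord0 /= !addr0 !addrA.
Qed.

(** The equations decouple into one system for the four diagonal coefficients and four systems of
    three equations for the twelve others. The former uses that neither |alpha|^2 nor |beta|^2 is 0,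
    the latter also that neither is 1/2. *)
Lemma kraus_gram_independent (M : 'M[C]_4) :
  `|alpha| ^+ 2 \notin [:: 0; 2^-1; 1] ->
  \sum_k \sum_l M k l *:
    ((kraus_op alpha beta k)^t* *m kraus_op alpha beta l) = 0 ->
  \sum_k \sum_l M k l *:
    (kraus_op alpha beta l *m (kraus_op alpha beta k)^t*) = 0 -> M = 0.
Proof.
rewrite !inE !negb_or => /and3P[n0 nhalf n1].
have hpq : alpha * alpha^* + beta * beta^* = 1 by rewrite -!normCK.
move: n0 nhalf n1; rewrite normCK => p0 phalf p1.
have q0 : beta * beta^* != 0.
  by apply: contraNneq p1 => q0; rewrite -hpq q0 addr0.
have [/andP[a0 a'0] /andP[b0 b'0]] : (alpha != 0) && (alpha^* != 0) /\
    (beta != 0) && (beta^* != 0) by rewrite -!negb_or -!mulf_eq0.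
have pp0 : 1 - (alpha * alpha^*) *+ 2 != 0.
  apply: contraNneq phalf => /eqP; rewrite subr_eq0 => /eqP e.
  by apply/eqP/(@mulIf _ 2); rewrite ?pnatr_eq0 // mulVf ?pnatr_eq0 // mulr_natr -e.
(* As |alpha|^2 + |beta|^2 = 1, this is the opposite of the previous quantity. *)
have qq0 : 1 - (beta * beta^*) *+ 2 != 0.
  rewrite (_ : _ - _ = - (1 - (alpha * alpha^*) *+ 2)) ?oppr_eq0 //.
  by rewrite -{1}hpq -[in RHS]hpq; ring.
pose m k l := M (inord k) (inord l).
have mE (k l : 'I_4) : M k l = m k l by rewrite /m !inord_val.
under eq_bigr => k _ do under eq_bigr => l _ do rewrite mE.
move=> /matrixP L.
under eq_bigr => k _ do under eq_bigr => l _ do rewrite mE.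
move=> /matrixP Rt.
(* Explicit ordinals let the [match] of the Gram formulas reduce by conversion in the equations
   below. *)
pose o0 : 'I_3 := @Ordinal 3 0 isT; pose o1 : 'I_3 := @Ordinal 3 1 isT.
pose o2 : 'I_3 := @Ordinal 3 2 isT.
have L' a b := etrans (esym (kraus_left_gramE alpha beta m a b)) (etrans (L a b) (mxE _ _ a b)).
have R' a b := etrans (esym (kraus_right_gramE alpha beta m a b)) (etrans (Rt a b) (mxE _ _ a b)).
have [m00 m11 m22 m33] :=
  diagonal_eq0 hpq p0 q0 (L' o1 o1) (R' o1 o1) (R' o0 o0) (L' o0 o0).
have l01 : - alpha^* * m 0%N 2%N - beta * m 2%N 1%N = 0 := L' o0 o1.
have l12 : alpha^* * m 1%N 3%N - beta * m 2%N 1%N = 0 := L' o1 o2.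
have r20 : alpha^* * beta^* * (m 1%N 3%N - m 0%N 2%N) - m 2%N 1%N = 0 := R' o2 o0.
have [m21 m02 m13] : [/\ m 2%N 1%N = 0, m 0%N 2%N = 0 & m 1%N 3%N = 0].
  apply: (off_diagonal_eq0 a'0 qq0).
  - by apply: subr0_eq; rewrite -oppr0 -l01; ring.
  - by apply: subr0_eq; rewrite -l12.
  - by apply: subr0_eq; rewrite -r20.
have l10 : - beta^* * m 1%N 2%N - alpha * m 2%N 0%N = 0 := L' o1 o0.
have l21 : alpha * m 3%N 1%N - beta^* * m 1%N 2%N = 0 := L' o2 o1.
have r02 : alpha * beta * (m 3%N 1%N - m 2%N 0%N) - m 1%N 2%N = 0 := R' o0 o2.
have [m12 m20 m31] : [/\ m 1%N 2%N = 0, m 2%N 0%N = 0 & m 3%N 1%N = 0].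
  (* The previous triple with its indices transposed and its coefficients conjugated. *)
  apply: (@off_diagonal_eq0 _ alpha beta^* beta) => //; first by rewrite mulrC.
  - by apply: subr0_eq; rewrite -oppr0 -l10; ring.
  - by apply: subr0_eq; rewrite -l21.
  - by apply: subr0_eq; rewrite -r02.
have r01 : beta * m 0%N 1%N + alpha * m 3%N 0%N = 0 := R' o0 o1.
have r12 : alpha * m 3%N 0%N - beta * m 2%N 3%N = 0 := R' o1 o2.
have l02 : alpha^* * beta * (m 0%N 1%N - m 2%N 3%N) + m 3%N 0%N = 0 := L' o0 o2.
have [m30 m01 m23] : [/\ m 3%N 0%N = 0, m 0%N 1%N = 0 & m 2%N 3%N = 0].
  (* Here alpha and beta exchange roles, so the determining factor is 1 - 2 |alpha|^2. *)
  apply: (off_diagonal_eq0 b0 pp0).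
  - by apply: subr0_eq; rewrite -r01; ring.
  - by apply: subr0_eq; rewrite -oppr0 -r12; ring.
  - by apply: subr0_eq; rewrite -oppr0 -l02; ring.
have r10 : beta^* * m 1%N 0%N + alpha^* * m 0%N 3%N = 0 := R' o1 o0.
have r21 : alpha^* * m 0%N 3%N - beta^* * m 3%N 2%N = 0 := R' o2 o1.
have l20 : alpha * beta^* * (m 1%N 0%N - m 3%N 2%N) + m 0%N 3%N = 0 := L' o2 o0.
have [m03 m10 m32] : [/\ m 0%N 3%N = 0, m 1%N 0%N = 0 & m 3%N 2%N = 0].
  apply: (@off_diagonal_eq0 _ beta^* alpha^* alpha) => //; first by rewrite mulrC.
  - by apply: subr0_eq; rewrite -r10; ring.
  - by apply: subr0_eq; rewrite -oppr0 -r21; ring.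
  - by apply: subr0_eq; rewrite -oppr0 -l20; ring.
apply/matrixP => k l; rewrite mE mxE.
by case: k l => [[|[|[|[|//]]]] ?] [[|[|[|[|//]]]] ?].
Qed.
End Example.

Theorem theorem2p1 (R : realType) (alpha beta : R[i])
    (hab : `|alpha| ^+ 2 + `|beta| ^+ 2 = 1) :
  (`|alpha| ^+ 2 \notin [:: 0; 2^-1; 1] ->
     extreme_point (@UCPT R 3) (Phi_ alpha beta)) /\
  exact_factorization 2 (Phi_ alpha beta).
Proof.
split=> [alphaN|]; last exact: Phi_exact_factorization.
have := Phi_UCPT hab; rewrite Phi_kraus_form => PhiU.
by apply: kraus_form_extreme => // M; apply: kraus_gram_independent.
Qed.
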